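(* Let $U$ be a fixed set. An object $\mathcal{F}_A$ of the category $\mathbf{Sset(U)}$ of soft sets over $U$ is a terminal object if and only if $\mathcal{F}_A$ is an absolute soft set with $|A|=1$.
   Context: Let $U$ be a fixed universal set. A soft set $\mathcal{F}_A$ over $U$ consists of a set $A$ (the parameter set, an arbitrary set, possibly empty) together with a function $\mathcal{F}:A\to\mathcal{P}(U)$, where $\mathcal{P}(U)$ is the power set of $U$. The soft set $\mathcal{F}_A$ is an absolute soft set if $\mathcal{F}(a)=U$ for all $a\in A$. A soft morphism from a soft set $\mathcal{F}_A$ to a soft set $\mathcal{G}_B$ is a function $\alpha:A\to B$ such that $\mathcal{F}(a)\subseteq(\mathcal{G}\circ\alpha)(a)$ for each $a\in A$; formally it is regarded as the triple $(\mathcal{F}_A,\alpha,\mathcal{G}_B)$. Composition is composition of functions and the identity soft morphism is the identity function. $\mathbf{Sset(U)}$ is the category whose objects are all soft sets over $U$ and whose morphisms are the soft morphisms. An object $X$ of a category is a terminal object if for each object $Y$, $|\hom(Y,X)|=1$. *)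

(* Defs.v *)
From mathcomp Require Import all_boot.
From mathcomp Require Import boolp classical_sets functions cardinality.

Set Implicit Arguments.
Unset Strict Implicit.
Unset Printing Implicit Defensive.

Local Open Scope classical_set_scope.
Local Open Scope card_scope.

Record category := Category {
  obj : Type;
  hom : obj -> obj -> Type;
  idm : forall X, hom X X;
  compm : forall X Y Z, hom Y Z -> hom X Y -> hom X Z;
  compm1 : forall X Y (f : hom X Y), compm f (idm X) = f;
  comp1m : forall X Y (f : hom X Y), compm (idm Y) f = f;
  compmA : forall X Y Z W (f : hom X Y) (g : hom Y Z) (h : hom Z W),
    compm h (compm g f) = compm (compm h g) f
}.

Definition terminal (C : category) (X : obj C) : Prop :=
  forall Y : obj C, [set: hom Y X] #= `I_1.

(* The parameter set is a bare type: it may be empty, and the function is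
   defined on parameters only. *)
Record soft_set (U : Type) := SoftSet {
  param : Type;
  soft_fun :> param -> set U
}.

Definition absolute (U : Type) (F : soft_set U) : Prop :=
  forall a : param F, F a = [set: U].

(* The source and target of the triple (F, alpha, G) are the type indices. *)
Record soft_morphism (U : Type) (F G : soft_set U) := SoftMorphism {
  morph_fun :> param F -> param G;
  morph_sub : forall a : param F, F a `<=` G (morph_fun a)
}.

Arguments morph_sub {U F G} _ a [t] _.

Lemma soft_morphism_eq (U : Type) (F G : soft_set U)
    (alpha beta : soft_morphism F G) :
  morph_fun alpha = morph_fun beta -> alpha = beta.
Proof.
case: alpha beta => [f Hf] [g Hg] /= efg; case: g / efg Hg => Hg.
by rewrite (Prop_irrelevance Hf Hg).
Qed.

Definition soft_id (U : Type) (F : soft_set U) : soft_morphism F F :=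
  @SoftMorphism U F F id (fun a => @subset_refl U (F a)).

Definition soft_comp (U : Type) (F G H : soft_set U)
    (beta : soft_morphism G H) (alpha : soft_morphism F G) :
    soft_morphism F H :=
  @SoftMorphism U F H (beta \o alpha)
    (fun a => subset_trans (morph_sub alpha a) (morph_sub beta (alpha a))).

Lemma soft_comp1 (U : Type) (F G : soft_set U) (alpha : soft_morphism F G) :
  soft_comp alpha (soft_id F) = alpha.
Proof. exact: soft_morphism_eq. Qed.

Lemma soft_1comp (U : Type) (F G : soft_set U) (alpha : soft_morphism F G) :
  soft_comp (soft_id G) alpha = alpha.
Proof. exact: soft_morphism_eq. Qed.

Lemma soft_compA (U : Type) (F G H K : soft_set U)
    (alpha : soft_morphism F G) (beta : soft_morphism G H)
    (gamma : soft_morphism H K) :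
  soft_comp gamma (soft_comp beta alpha) =
  soft_comp (soft_comp gamma beta) alpha.
Proof. exact: soft_morphism_eq. Qed.

Definition Sset (U : Type) : category :=
  @Category (soft_set U) (@soft_morphism U) (@soft_id U) (@soft_comp U)
    (@soft_comp1 U) (@soft_1comp U) (@soft_compA U).

(* Main.v *)
(* Morphisms into F from the one-parameter soft set with value [set0] are the
   parameters of F, so terminality makes the parameter set a singleton; a
   morphism from the one-parameter soft set with value U then forces the value
   at that parameter to be U. *)

Require Import Defs.
From mathcomp Require Import all_boot.
From mathcomp Require Import boolp classical_sets functions cardinality.

Local Open Scope classical_set_scope.
Local Open Scope card_scope.

(** Serves both for hom-sets and for the parameter set, replacing bijections with [I_1] by existence
    and uniqueness. *)
Lemma card_setT1P (T : Type) :
  [set: T] #= `I_1 <-> exists x : T, forall y, y = x.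
Proof.
split=> [/card_set_bijP[f [f_fun f_inj f_surj]] | [x eq_x]].
  have [x _ _] := f_surj 0 isT; exists x => y.
  have f0 z : f z = 0 by apply/eqP; rewrite -leqn0 -ltnS; exact: f_fun.
  by apply: f_inj; rewrite ?in_setT // !f0.
have -> : [set: T] = [set x] by apply/seteqP; split=> y //= _; exact: eq_x.
exact: card_set1.
Qed.

Theorem theorem2 (U : Type) (F : soft_set U) :
  @terminal (Sset U) F <-> absolute F /\ [set: param F] #= `I_1.
Proof.
split=> [F_term | [F_abs /card_setT1P[a eq_a]] G].
  have homP G : exists x : soft_morphism G F, forall y, y = x.
    exact/card_setT1P/F_term.
  pose pt (V : set U) := @SoftSet U unit (fun=> V).
  have [alpha _] := homP (pt [set: U]).
  have [beta eq_beta] := homP (pt set0).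
  have eq_pt b : b = beta tt.
    (* The underlying map of [SoftMorphism sub0] is inferred to be constant at [b]. *)
    have sub0 (t : param (pt set0)) : pt set0 t `<=` F b by exact: sub0set.
    by rewrite -(eq_beta (SoftMorphism sub0)).
  split; last by apply/card_setT1P; exists (beta tt).
  (* Both [b] and [alpha tt] equal [beta tt], so [b] may be replaced by [alpha tt], where [alpha]
     bounds the value below by [U]. *)
  move=> b; rewrite (eq_pt b) -(eq_pt (alpha tt)).
  by apply/seteqP; split=> // x; exact: (morph_sub alpha tt).
apply/card_setT1P.
(* The unique morphism is the constant map at [a]. *)
have sub_a (b : param G) : G b `<=` F a by rewrite F_abs; exact: subsetT.
exists (SoftMorphism sub_a) => beta.
by apply: soft_morphism_eq; apply/funext => b; rewrite (eq_a (beta b)).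
Qed.
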